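(* Let $\mathbf{k}$ be a field of characteristic zero and let $i,j,k$ be positive integers with $\mathrm{pgcd}(i,j,k)=1$. Then there exists a reduced triple $(I,J,K)$ such that $(i,j,k)\sim(I,J,K)$. In particular, the embeddings $(T_i,T_j,T_k)$ and $(T_I,T_J,T_K)$ of $\mathbb{A}^1$ in $\mathbb{A}^3$ are algebraically equivalent.
   Context: $T_n$ denotes the degree-$n$ Chebyshev polynomial of the first kind: $T_0=1$, $T_1=t$, $T_{n+1}=2tT_n-T_{n-1}$ for $n\ge1$, regarded as an element of $\mathbf{k}[t]$. For positive integers, $\mathrm{pgcd}(i,j,k)=\max\{\gcd(i,j),\gcd(i,k),\gcd(j,k)\}$. A morphism $\phi=(f_1,f_2,f_3):\mathbb{A}^1\to\mathbb{A}^3$ is an embedding iff $\mathbf{k}[f_1,f_2,f_3]=\mathbf{k}[t]$. Two embeddings $\phi,\psi:\mathbb{A}^1\to\mathbb{A}^3$ are algebraically equivalent if there is a polynomial automorphism $\alpha\in GA_3(\mathbf{k})$ of $\mathbb{A}^3$ with $\alpha\phi=\psi$. An elementary involution $\epsilon:\mathbb{A}^3\to\mathbb{A}^3$ is any polynomial map having one of the following forms: $(x,z,y)$, $(y,x,z)$, $(z,y,x)$; $(f(y,z)-x,y,z)$, $(x,f(x,z)-y,z)$, $(x,y,f(x,y)-z)$; $(g(z)-x,h(z)-y,z)$, $(g(y)-x,y,h(y)-z)$, $(x,g(x)-y,h(x)-z)$; where $f$ is a polynomial in two variables over $\mathbf{k}$ and $g,h$ are polynomials in one variable over $\mathbf{k}$.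 The equivalence relation $\sim$ on ordered triples of positive integers is defined by: $(i,j,k)\sim(a,b,c)$ iff there is a sequence of elementary involutions $\epsilon_1,\dots,\epsilon_m$ ($m\ge0$) such that $(T_i,T_j,T_k)=\epsilon_1\epsilon_2\cdots\epsilon_m(T_a,T_b,T_c)$. For positive integers $i,j$ with $\gcd(i,j)=1$, let $\langle i,j\rangle$ be the semigroup of positive integers generated by $i$ and $j$ (all positive integers $ai+bj$ with integers $a,b\ge0$). The remnant of $i$ and $j$ is $\ll i,j\gg=\{k\in\mathbb{N} \mid k>\max(i,j),\ k\notin\langle i,j\rangle,\ \mathrm{pgcd}(i,j,k)=1\}$. An ordered triple $(i,j,k)$ of positive integers is a reduced triple iff either (a) $1\in\{i,j,k\}$, or (b) $2\le i<j$, $\gcd(i,j)=1$, and $k\in\ll i,j\gg$. *)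

(* Defs.v *)
From mathcomp Require Import all_boot all_order all_algebra.
From mathcomp Require Import mpoly.

Set Implicit Arguments.
Unset Strict Implicit.
Unset Printing Implicit Defensive.

Import GRing.Theory.
Local Open Scope ring_scope.

Fixpoint chebyshev (k : fieldType) (n : nat) : {poly k} :=
  match n with
  | 0 => 1
  | 1 => 'X
  | (m.+1 as p).+1 => 2%:R *: ('X * chebyshev k p) - chebyshev k m
  end.

(* A morphism A^1 -> A^3, given by its three coordinate polynomials in k[t]. *)
Definition curve (k : fieldType) : Type := 3.-tuple {poly k}.

(* A polynomial map A^3 -> A^3, given by its three coordinate polynomials. *)
Definition polymap (k : fieldType) : Type := 3.-tuple {mpoly k[3]}.

(* F(f_1, f_2, f_3) for phi = (f_1, f_2, f_3). *)
Definition subst_curve (k : fieldType) (phi : curve k) (F : {mpoly k[3]}) :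
    {poly k} :=
  mmap polyC (tnth phi) F.

Definition map_curve (k : fieldType) (alpha : polymap k) (phi : curve k) :
    curve k :=
  [tuple of map (subst_curve phi) alpha].

Definition polymap_id (k : fieldType) : polymap k := [tuple 'X_i | i < 3].

(* alpha after beta; [p \mPo lq] substitutes the tuple [lq] in [p]. *)
Definition polymap_comp (k : fieldType) (alpha beta : polymap k) : polymap k :=
  [tuple of map (comp_mpoly beta) alpha].

Definition automorphism (k : fieldType) (alpha : polymap k) : Prop :=
  exists beta : polymap k,
    polymap_comp alpha beta = polymap_id k /\
    polymap_comp beta alpha = polymap_id k.

(* k[f_1, f_2, f_3] = k[t]. *)
Definition embedding (k : fieldType) (phi : curve k) : Prop :=
  forall p : {poly k}, exists F : {mpoly k[3]}, subst_curve phi F = p.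

Definition algebraically_equivalent (k : fieldType) (phi psi : curve k) :
    Prop :=
  [/\ embedding phi, embedding psi &
      exists2 alpha : polymap k, automorphism alpha & map_curve alpha phi = psi].

Definition subst2 (k : fieldType) (f : {mpoly k[2]}) (u v : {mpoly k[3]}) :
    {mpoly k[3]} :=
  f \mPo [tuple u; v].

Definition subst1 (k : fieldType) (g : {poly k}) (u : {mpoly k[3]}) :
    {mpoly k[3]} :=
  (map_poly (@mpolyC 3 k) g).[u].

Local Notation x := ('X_(@Ordinal 3 0 isT)).
Local Notation y := ('X_(@Ordinal 3 1 isT)).
Local Notation z := ('X_(@Ordinal 3 2 isT)).

Inductive elementary_involution (k : fieldType) : polymap k -> Prop :=
  | EI_swap_yz : elementary_involution [tuple x; z; y]
  | EI_swap_xy : elementary_involution [tuple y; x; z]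
  | EI_swap_xz : elementary_involution [tuple z; y; x]
  | EI_x (f : {mpoly k[2]}) :
      elementary_involution [tuple subst2 f y z - x; y; z]
  | EI_y (f : {mpoly k[2]}) :
      elementary_involution [tuple x; subst2 f x z - y; z]
  | EI_z (f : {mpoly k[2]}) :
      elementary_involution [tuple x; y; subst2 f x y - z]
  | EI_xy (g h : {poly k}) :
      elementary_involution [tuple subst1 g z - x; subst1 h z - y; z]
  | EI_xz (g h : {poly k}) :
      elementary_involution [tuple subst1 g y - x; y; subst1 h y - z]
  | EI_yz (g h : {poly k}) :
      elementary_involution [tuple x; subst1 g x - y; subst1 h x - z].

Definition chebyshev_curve (k : fieldType) (i j l : nat) : curve k :=
  [tuple chebyshev k i; chebyshev k j; chebyshev k l].

(* (i,j,l) ~ (a,b,c): with es = [:: e_1; ...; e_m], the right-hand side below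
   is e_1 (e_2 (... (e_m (T_a, T_b, T_c)))). *)
Definition chebyshev_sim (k : fieldType) (i j l a b c : nat) : Prop :=
  exists2 es : seq (polymap k),
    (forall e, e \in (es : seq (3.-tuple {mpoly k[3]})) ->
               elementary_involution e) &
    chebyshev_curve k i j l =
      foldr (@map_curve k) (chebyshev_curve k a b c) es.

Definition pgcd (i j l : nat) : nat :=
  maxn (gcdn i j) (maxn (gcdn i l) (gcdn j l)).

Definition in_semigroup (i j n : nat) : Prop :=
  (0 < n)%N /\ exists a b : nat, n = (a * i + b * j)%N.

(* Meaningful for coprime positive i and j. *)
Definition in_remnant (i j l : nat) : Prop :=
  [/\ (maxn i j < l)%N, ~ in_semigroup i j l & pgcd i j l = 1%N].

Definition reduced_triple (i j l : nat) : Prop :=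
  [/\ (0 < i)%N, (0 < j)%N & (0 < l)%N] /\
  (1%N \in [:: i; j; l] \/
   [/\ (2 <= i)%N, (i < j)%N, gcdn i j = 1%N & in_remnant i j l]).

(* Main.v *)
Require Import Defs.
From mathcomp Require Import all_boot all_order all_algebra.
From mathcomp Require Import mpoly.
From mathcomp Require Import zify ring.

(** With [T_m] extended to integers by [T_{-m} = T_m], the product formula
    [2 T_m T_n = T_{m+n} + T_{m-n}] gives
    [T_{ai+bj} = 2 T_a(T_i) T_b(T_j) - T_{|ai-bj|}], so a single involution in
    the third coordinate replaces [ai + bj] by [|ai - bj|].  This preserves
    pairwise coprimality and decreases the sum of the triple, and the descent
    can only stop at a reduced triple.

    For the embedding property, work modulo the algebra [A] generated by [T_i],
    [T_j], [T_l].  It contains [T_{ai+bj} + T_{ai-bj}] for all integers [a] and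
    [b], which forces [m |-> T_m mod A] to have period [2ij]; likewise it has
    periods [2il] and [2jl], hence period [2].  One of
    [i], [j], [l], say [c], is odd, so [T_c] in [A] gives [T_1 = 'X] in [A]. *)

Set Implicit Arguments.
Unset Strict Implicit.
Unset Printing Implicit Defensive.

Import GRing.Theory.
Local Open Scope ring_scope.

(** * Substitution into multivariate polynomials *)

Lemma mmap_eq (n : nat) (R S : nzRingType) (f : {rmorphism R -> S})
    (h1 h2 : 'I_n -> S) (p : {mpoly R[n]}) :
  h1 =1 h2 -> mmap f h1 p = mmap f h2 p.
Proof.
by move=> eq_h; apply: eq_bigr => m _; rewrite (mmap1_eq m eq_h).
Qed.

(** The target ring is left general so that evaluation along a curve and composition of polynomial
    maps are both instances. *)
Lemma mmap_comp_mpoly (n m : nat) (R : nzRingType) (S : comNzRingType)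
    (f : {rmorphism R -> S}) (h : 'I_m -> S) (lq : n.-tuple {mpoly R[m]})
    (p : {mpoly R[n]}) :
  mmap f h (p \mPo lq) = mmap f (fun i => mmap f h (tnth lq i)) p.
Proof.
rewrite comp_mpolyE rmorph_sum /=; apply: eq_bigr => u _.
rewrite mmapZ rmorph_prod /=; congr (_ * _).
by apply: eq_bigr => i _; rewrite rmorphXn.
Qed.

Lemma mmap_horner_mpolyC (n : nat) (R : nzRingType) (S : comNzRingType)
    (f : {rmorphism R -> S}) (h : 'I_n -> S) (u : {mpoly R[n]}) (g : {poly R}) :
  mmap f h (map_poly (@mpolyC n R) g).[u] = (map_poly f g).[mmap f h u].
Proof.
rewrite -horner_map -map_poly_comp /=; congr _.[_].
by apply: eq_map_poly => c /=; rewrite mmapC.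
Qed.

(** * Polynomial maps acting on curves, and involutivity *)

Section Curves.
Variable k : fieldType.
Implicit Types (phi psi : curve k) (alpha beta gamma : polymap k).

Lemma map_curve_comp alpha beta phi :
  map_curve (polymap_comp alpha beta) phi
  = map_curve alpha (map_curve beta phi).
Proof.
apply: eq_from_tnth => c; rewrite !tnth_map /subst_curve mmap_comp_mpoly.
by apply: mmap_eq => d; rewrite tnth_map.
Qed.

Lemma map_curve_id phi : map_curve (polymap_id k) phi = phi.
Proof.
apply: eq_from_tnth => c.
by rewrite tnth_map tnth_mktuple /subst_curve mmapX mmap1U.
Qed.

Lemma polymap_compA alpha beta gamma :
  polymap_comp (polymap_comp alpha beta) gamma
  = polymap_comp alpha (polymap_comp beta gamma).
Proof.
apply: eq_from_tnth => c; rewrite !tnth_map /comp_mpoly mmap_comp_mpoly.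
by apply: mmap_eq => d; rewrite tnth_map.
Qed.

Lemma polymap_comp_idl alpha : polymap_comp (polymap_id k) alpha = alpha.
Proof.
apply: eq_from_tnth => c.
by rewrite tnth_map tnth_mktuple comp_mpolyXU -tnth_nth.
Qed.

Lemma polymap_comp_idr alpha : polymap_comp alpha (polymap_id k) = alpha.
Proof. by apply: eq_from_tnth => c; rewrite tnth_map comp_mpoly_id. Qed.

Lemma automorphism_id : automorphism (polymap_id k).
Proof. by exists (polymap_id k); rewrite polymap_comp_idl. Qed.

Lemma automorphism_comp alpha beta :
  automorphism alpha -> automorphism beta ->
  automorphism (polymap_comp alpha beta).
Proof.
move=> [a [Ka aK]] [b [Kb bK]]; exists (polymap_comp b a); split.
  by rewrite polymap_compA -(polymap_compA beta) Kb polymap_comp_idl.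
by rewrite polymap_compA -(polymap_compA a) aK polymap_comp_idl.
Qed.

Lemma subst2_comp (f : {mpoly k[2]}) (u v : {mpoly k[3]}) beta :
  subst2 f u v \mPo beta = subst2 f (u \mPo beta) (v \mPo beta).
Proof.
rewrite [LHS]mmap_comp_mpoly; apply: mmap_eq => -[[|[|//]] lt_c2];
by rewrite !(tnth_nth 0).
Qed.

Lemma subst1_comp (g : {poly k}) (u : {mpoly k[3]}) beta :
  subst1 g u \mPo beta = subst1 g (u \mPo beta).
Proof. exact: mmap_horner_mpolyC. Qed.

(** The polynomial in a changed coordinate involves only coordinates that the map fixes, so a second
    application gives [f - (f - x) = x]. *)
Lemma elementary_involutionK alpha :
  elementary_involution alpha -> polymap_comp alpha alpha = polymap_id k.
Proof.
case=> [|||f|f|f|g h|g h|g h]; apply: eq_from_tnth;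
  case=> -[|[|[|//]]] lt_c3; rewrite tnth_map tnth_mktuple !(tnth_nth 0) /=;
  rewrite ?rmorphB /= ?subst2_comp ?subst1_comp ?comp_mpolyXU /= ?subKr;
  by congr 'X_ _; exact: val_inj.
Qed.

End Curves.

(** * Subalgebras of [k[t]] generated by finitely many polynomials *)

Section Generation.
Variables (k : fieldType) (n : nat) (h : 'I_n -> {poly k}).

(** The number [n] of generators varies: three for the embedding property, two for the polynomial of
    a descent step. *)
Definition generated (p : {poly k}) : Prop :=
  exists F : {mpoly k[n]}, mmap polyC h F = p.

Lemma generatedC c : generated c%:P.
Proof. by exists c%:MP; rewrite mmapC. Qed.

Lemma generated_gen c : generated (h c).
Proof. by exists 'X_c; rewrite mmapX mmap1U. Qed.

Lemma generatedN p : generated p -> generated (- p).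
Proof. by case=> F <-; exists (- F); rewrite rmorphN. Qed.

Lemma generatedD p q : generated p -> generated q -> generated (p + q).
Proof. by case=> F <- [G <-]; exists (F + G); rewrite rmorphD. Qed.

Lemma generatedB p q : generated p -> generated q -> generated (p - q).
Proof. by move=> gp gq; apply: generatedD => //; apply: generatedN. Qed.

Lemma generatedM p q : generated p -> generated q -> generated (p * q).
Proof. by case=> F <- [G <-]; exists (F * G); rewrite rmorphM. Qed.

Lemma generatedT : generated 'X -> forall p, generated p.
Proof.
move=> gX; elim/poly_ind => [|p c gp].
  by rewrite -polyC0; apply: generatedC.
by apply: generatedD; [apply: generatedM | apply: generatedC].
Qed.

End Generation.

(** * Chebyshev polynomials with integer index *)

Section Chebyshev.
Variable k : fieldType.

Definition chebz (m : int) : {poly k} := chebyshev k `|m|%N.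

Lemma chebzN m : chebz (- m) = chebz m.
Proof. by rewrite /chebz abszN. Qed.

Lemma chebz_rec (m : int) :
  chebz (m + 1) + chebz (m - 1) = 2%:R * 'X * chebz m.
Proof.
have rec (a : nat) : chebz (a.+2%:Z) + chebz a%:Z = 2%:R * 'X * chebz a.+1%:Z.
  by rewrite /chebz /= subrK scaler_nat -mulrA mulr_natl.
have pos (a : nat) :
    chebz (a%:Z + 1) + chebz (a%:Z - 1) = 2%:R * 'X * chebz a%:Z.
  case: a => [|a]; first by rewrite /chebz /= mulr1 mulr_natl mulr2n.
  have -> : a.+1%:Z + 1 = a.+2%:Z by lia.
  by have -> : a.+1%:Z - 1 = a%:Z by lia.
(* Negative indices reduce to positive ones: [m |-> -m] exchanges the two terms on the left. *)
case: (intP m) => [|a|a]; [exact: (pos 0)|exact: (pos a.+1)|].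
rewrite (chebzN a.+1) -(pos a.+1) -(chebzN (- _ + 1)) -(chebzN (- _ - 1)).
by rewrite addrC !opprD !opprK.
Qed.

(** As functions of [n], both sides satisfy the recurrence [u (n + 1) = 2 'X u n - u (n - 1)] and
    agree at 0 and 1. *)
Lemma chebzM (m n : int) :
  2%:R * chebz m * chebz n = chebz (m + n) + chebz (m - n).
Proof.
have pos (b : nat) :
    2%:R * chebz m * chebz b%:Z = chebz (m + b%:Z) + chebz (m - b%:Z).
  elim/ltn_ind: b => -[|[|b]] IH.
  - by rewrite !addr0 /chebz /= mulr1 mulr_natl mulr2n.
  - by rewrite chebz_rec {2}/chebz /= mulrAC.
  have := IH b.+1 (ltnSn _); have := IH b (ltnW (ltnSn _)).
  have := chebz_rec (m + b.+1%:Z); have := chebz_rec (m - b.+1%:Z).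
  have := chebz_rec b.+1.
  have -> : b.+1%:Z + 1 = b.+2%:Z by lia.
  have -> : b.+1%:Z - 1 = b%:Z by lia.
  have -> : m + b.+1%:Z + 1 = m + b.+2%:Z by lia.
  have -> : m + b.+1%:Z - 1 = m + b%:Z by lia.
  have -> : m - b.+1%:Z + 1 = m - b%:Z by lia.
  have -> : m - b.+1%:Z - 1 = m - b.+2%:Z by lia.
  move: (chebz b) (chebz b.+1) (chebz b.+2) (chebz m) => B B1 B2 M.
  (* The three recurrences are solved for the terms with shift [b + 2]; the induction hypotheses
     then settle the rest. *)
  move=> /(canRL (addrK _)) -> /(canRL (addKr _)) -> /(canRL (addrK _)) ->.
  move=> e0 e1.
  have -> : 2%:R * M * (2%:R * 'X * B1 - B)
     = 2%:R * 'X * (2%:R * M * B1) - 2%:R * M * B by ring.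
  by rewrite e0 e1; ring.
case: (intP n) => [|b|b]; [exact: (pos 0)|exact: (pos b.+1)|].
by rewrite chebzN pos opprK addrC.
Qed.

(** [T_{ai} = T_a(T_i)] is a polynomial in [T_i]: the product formula with factor [T_i] is a
    three-term recurrence in [a]. *)
Lemma generated_chebyshevM (n : nat) (h : 'I_n -> {poly k}) (i : nat) (a : int) :
  generated h (chebyshev k i) -> generated h (chebz (a * i%:Z)).
Proof.
move=> gi; have gpos (b : nat) : generated h (chebz (b%:Z * i%:Z)).
  elim/ltn_ind: b => -[|[|b]] IH.
  - by rewrite mul0r /chebz /= -polyC1; apply: generatedC.
  - by rewrite mul1r.
  have -> : chebz (b.+2%:Z * i%:Z) =
      2%:R * chebz i%:Z * chebz (b.+1%:Z * i%:Z) - chebz (b%:Z * i%:Z).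
    apply: (canRL (addrK _)); rewrite mulrAC chebzM.
    by congr (chebz _ + chebz _); lia.
  apply: generatedB; last by apply: IH.
  apply: generatedM; last by apply: IH.
  by apply: generatedM => //; rewrite -polyC_natr; apply: generatedC.
case: (intP a) => [|b|b]; [exact: (gpos 0)|exact: (gpos b.+1)|].
by rewrite mulNr chebzN.
Qed.

Lemma generated_chebz_pair (n : nat) (h : 'I_n -> {poly k}) (i j : nat)
    (a b : int) :
  generated h (chebyshev k i) -> generated h (chebyshev k j) ->
  generated h (chebz (a * i%:Z + b * j%:Z) + chebz (a * i%:Z - b * j%:Z)).
Proof.
move=> gi gj; rewrite -chebzM; apply: generatedM; last exact: generated_chebyshevM.
apply: generatedM; last exact: generated_chebyshevM.
by rewrite -polyC_natr; apply: generatedC.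
Qed.

(** * Periods of [m |-> T_m] modulo a generated algebra *)

Definition period (n : nat) (h : 'I_n -> {poly k}) (d : int) : Prop :=
  forall m : int, generated h (chebz (m + d) - chebz m).

Lemma periodD (n : nat) (h : 'I_n -> {poly k}) d e :
  period h d -> period h e -> period h (d + e).
Proof.
move=> pd pe m; rewrite addrA -(subrKA (chebz (m + d))).
by apply: generatedD; [apply: pe | apply: pd].
Qed.

Lemma periodN (n : nat) (h : 'I_n -> {poly k}) d : period h d -> period h (- d).
Proof.
move=> pd m; rewrite -opprB; apply: generatedN.
by rewrite -{1}(subrK d m).
Qed.

Lemma periodM (n : nat) (h : 'I_n -> {poly k}) d e :
  period h d -> period h (e * d).
Proof.
move=> pd; have gpos (b : nat) : period h (b%:Z * d).
  elim: b => [|b IH]; last by rewrite -addn1 PoszD mulrDl mul1r; apply: periodD.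
  by move=> m; rewrite mul0r addr0 subrr -polyC0; apply: generatedC.
case: (intP e) => [|b|b]; [exact: (gpos 0)|exact: (gpos b.+1)|].
by rewrite mulNr; apply: periodN.
Qed.

Lemma coprime_bezout (i j : nat) :
  coprime i j -> exists u v : int, u * i%:Z + v * j%:Z = 1.
Proof.
move=> /eqP cij; have [u [v e]] := Bezoutz i j.
by exists u, v; rewrite e /gcdz /= cij.
Qed.

(* Write [m] as [a i - b j]; the pair [(a + j, b - i)] has the same sum
   [a i + b j], while its difference is [m + 2 i j]. *)
Lemma period_coprime (n : nat) (h : 'I_n -> {poly k}) (i j : nat) :
  generated h (chebyshev k i) -> generated h (chebyshev k j) -> coprime i j ->
  period h (2%:Z * i%:Z * j%:Z).
Proof.
move=> gi gj /coprime_bezout[u [v e]] m.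
have g0 := generated_chebz_pair (m * u) (- (m * v)) gi gj.
have g1 := generated_chebz_pair (m * u + j%:Z) (- (m * v) - i%:Z) gi gj.
have em : m = m * u * i%:Z - - (m * v) * j%:Z.
  by rewrite mulNr opprK -!mulrA -mulrDr e mulr1.
have := generatedB g1 g0; rewrite -em.
have -> : (m * u + j%:Z) * i%:Z + (- (m * v) - i%:Z) * j%:Z
  = m * u * i%:Z + - (m * v) * j%:Z by ring.
have -> : (m * u + j%:Z) * i%:Z - (- (m * v) - i%:Z) * j%:Z
  = m + 2%:Z * i%:Z * j%:Z by rewrite {3}em; ring.
by rewrite opprD addrACA subrr add0r.
Qed.

Lemma chebyshev_curve_embedding (i j l : nat) :
  coprime i j -> coprime i l -> coprime j l ->
  embedding (chebyshev_curve k i j l).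
Proof.
move=> cij cil cjl.
pose h := tnth (chebyshev_curve k i j l).
have gi : generated h (chebyshev k i) := generated_gen h (@Ordinal 3 0 isT).
have gj : generated h (chebyshev k j) := generated_gen h (@Ordinal 3 1 isT).
have gl : generated h (chebyshev k l) := generated_gen h (@Ordinal 3 2 isT).
have p2 : period h 2%:Z.
  have [u [v euv]] : exists u v : int, u * i%:Z + v * (j * l)%:Z = 1.
    by apply: coprime_bezout; rewrite coprimeMr cij.
  have [s [t est]] := coprime_bezout cjl.
  (* Substituting [1 = s j + t l] into [1 = u i + v j l] and doubling expresses 2 through the
     periods [2ij], [2il], [2jl]. *)
  have -> : 2%:Z = u * s * (2%:Z * i%:Z * j%:Z) +
      u * t * (2%:Z * i%:Z * l%:Z) + v * (2%:Z * j%:Z * l%:Z).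
    transitivity (2%:Z * (u * i%:Z * (s * j%:Z + t * l%:Z) + v * (j * l)%:Z)).
      by rewrite est mulr1 euv mulr1.
    by rewrite PoszM; ring.
  by apply: periodD; [apply: periodD|]; apply: periodM; apply: period_coprime.
have even_shift (m q : int) :
    generated h (chebz m) -> generated h (chebz (m + q * 2%:Z)).
  by move=> gm; rewrite -(subrK (chebz m) (chebz _)); apply: generatedD => //; apply: periodM.
have odd_gen (c : nat) : odd c -> generated h (chebyshev k c) -> generated h 'X.
  move=> oc /(even_shift c%:Z (- (c./2)%:Z)).
  by have -> : c%:Z + - (c./2)%:Z * 2%:Z = 1 by lia.
suff gX : generated h 'X by move=> p; apply: (generatedT gX).
(* Being coprime, [i] and [j] are not both even, so one of them is the required odd index. *)
have [/odd_gen|ei] := boolP (odd i); first exact.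
apply: (odd_gen j) => //; apply/negPn/negP => ej.
have: (2 %| gcdn i j)%N by rewrite dvdn_gcd !dvdn2 ei ej.
by rewrite (eqP cij).
Qed.

End Chebyshev.

(** * Chains of involutions between Chebyshev curves *)

Section Similarity.
Variable k : fieldType.

Lemma chebyshev_sim_refl (i j l : nat) : chebyshev_sim k i j l i j l.
Proof. by exists [::]. Qed.

Lemma chebyshev_sim_step (i j l i' j' l' a b c : nat) (e : polymap k) :
  elementary_involution e ->
  chebyshev_curve k i j l = map_curve e (chebyshev_curve k i' j' l') ->
  chebyshev_sim k i' j' l' a b c -> chebyshev_sim k i j l a b c.
Proof.
move=> eie eq_i [es es_ei eq_i']; exists (e :: es); last by rewrite eq_i eq_i'.
by move=> e'; rewrite inE => /predU1P[->|/es_ei].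
Qed.

(** Each involution is its own inverse, so composing the chain in reverse order gives an
    automorphism carrying the first curve to the second. *)
Lemma chebyshev_sim_equivalent (i j l a b c : nat) :
  embedding (chebyshev_curve k i j l) -> embedding (chebyshev_curve k a b c) ->
  chebyshev_sim k i j l a b c ->
  algebraically_equivalent (chebyshev_curve k i j l) (chebyshev_curve k a b c).
Proof.
move=> emb emb' [es es_ei eq_es]; split=> //; rewrite {}eq_es {emb emb'}.
move: (chebyshev_curve k a b c) => phi.
elim: es es_ei => [|e es IH] es_ei.
  by exists (polymap_id k); [apply: automorphism_id | apply: map_curve_id].
have Ke : polymap_comp e e = polymap_id k.
  by apply: elementary_involutionK; apply: es_ei; rewrite mem_head.
have [e' e'_in|alpha alpha_aut alphaE] := IH.
  by apply: es_ei; rewrite inE e'_in orbT.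
exists (polymap_comp alpha e).
  by apply: automorphism_comp => //; exists e.
by rewrite /= map_curve_comp -(map_curve_comp e) Ke map_curve_id.
Qed.

Lemma chebyshev_sim_swap_xy (i j l a b c : nat) :
  chebyshev_sim k j i l a b c -> chebyshev_sim k i j l a b c.
Proof.
apply: chebyshev_sim_step (EI_swap_xy k) _; apply: val_inj => /=.
by rewrite /subst_curve !mmapX !mmap1U !(tnth_nth 0).
Qed.

Lemma chebyshev_sim_swap_yz (i j l a b c : nat) :
  chebyshev_sim k i l j a b c -> chebyshev_sim k i j l a b c.
Proof.
apply: chebyshev_sim_step (EI_swap_yz k) _; apply: val_inj => /=.
by rewrite /subst_curve !mmapX !mmap1U !(tnth_nth 0).
Qed.

Lemma chebyshev_sim_descent (i j a b c d e : nat) :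
  chebyshev_sim k i j `|(a * i)%:Z - (b * j)%:Z|%N c d e ->
  chebyshev_sim k i j (a * i + b * j) c d e.
Proof.
(* Only two generators are taken, so that the witness [f] is a polynomial in two variables, as
   [EI_z] requires; [f(T_i, T_j)] is the sum of the old and new third coordinates. *)
pose h := tnth [tuple chebyshev k i; chebyshev k j].
have gi : generated h (chebyshev k i) := generated_gen h (@Ordinal 2 0 isT).
have gj : generated h (chebyshev k j) := generated_gen h (@Ordinal 2 1 isT).
have [f fE] := generated_chebz_pair a%:Z b%:Z gi gj.
apply: chebyshev_sim_step (EI_z f) _; apply: val_inj => /=.
rewrite /subst_curve rmorphB /= !mmapX !mmap1U !(tnth_nth 0) /=.
congr [:: _; _; _].
rewrite [X in X - _]mmap_comp_mpoly.
rewrite (mmap_eq polyC (h2 := h)) ?fE ?PoszM ?addrK //.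
by case=> -[|[|//]] lt_c2; rewrite !(tnth_nth 0) /= mmapX mmap1U !(tnth_nth 0).
Qed.

End Similarity.

(** * Arithmetic of pairwise coprimality and of the semigroup *)

Lemma pgcd_eq1 (i j l : nat) : (0 < i)%N -> (0 < j)%N ->
  pgcd i j l = 1%N <-> [/\ coprime i j, coprime i l & coprime j l].
Proof.
move=> i_gt0 j_gt0; rewrite /pgcd /coprime.
(* All three gcds are at least 1, so their maximum is 1 exactly when each of them is. *)
have: (0 < gcdn i j)%N by rewrite gcdn_gt0 i_gt0.
have: (0 < gcdn i l)%N by rewrite gcdn_gt0 i_gt0.
have: (0 < gcdn j l)%N by rewrite gcdn_gt0 j_gt0.
by split=> [|[]]; first split; lia.
Qed.

(** Since [i] and [j] are positive, both coefficients are at most [n], and a finite search decides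
    membership. *)
Lemma in_semigroup_dec (i j n : nat) : (0 < i)%N -> (0 < j)%N ->
  in_semigroup i j n \/ ~ in_semigroup i j n.
Proof.
move=> i_gt0 j_gt0; case: (posnP n) => [->|n_gt0]; first by right=> -[].
have [/existsP[a /existsP[b /eqP e]]|no] :=
    boolP [exists a : 'I_n.+1, exists b : 'I_n.+1, n == (a * i + b * j)%N].
  by left; split=> //; exists a, b.
right=> -[_ [a [b e]]]; case/negP: no.
have lt_a : (a < n.+1)%N by nia.
have lt_b : (b < n.+1)%N by nia.
apply/existsP; exists (Ordinal lt_a).
by apply/existsP; exists (Ordinal lt_b); apply/eqP.
Qed.

(** Modulo [i], the numbers [ai + bj] and [ai - bj] are [bj] and [-bj]. *)
Lemma coprime_distn (i j a b : nat) :
  coprime i (a * i + b * j) -> coprime i `|(a * i)%:Z - (b * j)%:Z|.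
Proof.
rewrite /coprime gcdnMDl => /eqP cib; apply/eqP.
have: gcdz i%:Z ((a * i)%:Z - (b * j)%:Z) = 1.
  by rewrite PoszM gcdzMDl gcdzN /gcdz /= cib.
by case.
Qed.

(** * Descent to a reduced triple *)

Definition reducible (k : fieldType) (i j l : nat) : Prop :=
  exists I J K : nat, reduced_triple I J K /\ chebyshev_sim k i j l I J K.

Lemma reducible_swap_xy (k : fieldType) (i j l : nat) :
  reducible k j i l -> reducible k i j l.
Proof.
move=> [I [J [K [red sim]]]]; exists I, J, K; split=> //.
exact: chebyshev_sim_swap_xy.
Qed.

Lemma reducible_swap_yz (k : fieldType) (i j l : nat) :
  reducible k i l j -> reducible k i j l.
Proof.
move=> [I [J [K [red sim]]]]; exists I, J, K; split=> //.
exact: chebyshev_sim_swap_yz.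
Qed.

Lemma reduced_reducible (k : fieldType) (i j l : nat) :
  reduced_triple i j l -> reducible k i j l.
Proof. by exists i, j, l; split=> //; apply: chebyshev_sim_refl. Qed.

Lemma coprime_reducible (k : fieldType) (i j l : nat) :
  (0 < i)%N -> (0 < j)%N -> (0 < l)%N ->
  coprime i j -> coprime i l -> coprime j l -> reducible k i j l.
Proof.
have [n] := ubnP (i + j + l)%N; elim: n => // n IH in i j l *.
move=> lt_n i_gt0 j_gt0 l_gt0 cij cil cjl.
have [one|no1] := boolP (1%N \in [:: i; j; l]).
  by apply: reduced_reducible; split=> //; left.
(* For increasing triples without 1, either [z] lies in the remnant or it is [ax + by] and the
   descent applies. *)
have sorted (x y z : nat) : (x + y + z < n.+1)%N -> (1 < x)%N -> (x < y < z)%N ->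
    coprime x y -> coprime x z -> coprime y z -> reducible k x y z.
  move=> lt_xyz x_gt1 /andP[lt_xy lt_yz] cxy cxz cyz.
  have x_gt0 : (0 < x)%N by lia.
  have y_gt0 : (0 < y)%N by lia.
  have [[_ [a [b ez]]]|no_ab] := in_semigroup_dec z x_gt0 y_gt0; last first.
    apply: reduced_reducible; split; first by split; lia.
    right; split=> //; first exact/eqP.
    by split=> //; [lia | apply/pgcd_eq1].
  have [|||||||I [J [K [red sim]]]] := IH x y `|(a * x)%:Z - (b * y)%:Z|%N => //.
  (* The sum drops because [|ax - by| < ax + by] for positive [a], [b]. If one of them were 0, [z]
     would be a multiple of [x] or [y], against coprimality, as both exceed 1. *)
  - suff: (0 < a)%N /\ (0 < b)%N by nia.
    split; rewrite lt0n; apply/eqP=> e0; move: cxz cyz;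
      rewrite ez e0 mul0n ?addn0 ?add0n.
      by move=> _; rewrite coprimeMr => /andP[_]; rewrite /coprime gcdnn; lia.
    by rewrite coprimeMr => /andP[_]; rewrite /coprime gcdnn; lia.
  (* The new entry is nonzero: [ax = by] would make [z = 2ax] a multiple of [x]. *)
  - rewrite absz_gt0 subr_eq0; apply/eqP=> -[e].
    move: cxz; rewrite ez -e -mulnDl coprimeMr => /andP[_].
    by rewrite /coprime gcdnn; lia.
  - by apply: coprime_distn; rewrite -ez.
  - by rewrite distnC; apply: coprime_distn; rewrite addnC -ez.
  by exists I, J, K; split=> //; rewrite ez; apply: chebyshev_sim_descent.
(* Coprime entries other than 1 are distinct, so swaps can bring the triple into strictly increasing
   order. *)
have neq (x y : nat) : coprime x y -> 1%N != x -> x != y.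
  move=> cxy; apply: contraNneq => exy.
  by rewrite exy /coprime gcdnn eq_sym in cxy *.
move: no1; rewrite !inE !negb_or => /and3P[i1 j1 l1].
move: (neq _ _ cij i1) (neq _ _ cil i1) (neq _ _ cjl j1) => nij nil njl.
have [cji cli clj] : [/\ coprime j i, coprime l i & coprime l j].
  by rewrite ![coprime l _]coprime_sym [coprime j i]coprime_sym.
have : [|| (i < j < l)%N, (i < l < j)%N, (j < i < l)%N, (j < l < i)%N,
          (l < i < j)%N | (l < j < i)%N] by lia.
case/or4P => [o|o|o|/or3P[]o].
- by apply: sorted => //; lia.
- by apply: reducible_swap_yz; apply: sorted => //; lia.
- by apply: reducible_swap_xy; apply: sorted => //; lia.
- apply: reducible_swap_xy; apply: reducible_swap_yz.
  by apply: sorted => //; lia.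
- apply: reducible_swap_yz; apply: reducible_swap_xy.
  by apply: sorted => //; lia.
apply: reducible_swap_xy; apply: reducible_swap_yz; apply: reducible_swap_xy.
by apply: sorted => //; lia.
Qed.

(** * Reduced triples as embeddings, and the conclusion *)

Lemma reduced_triple_embedding (k : fieldType) (i j l : nat) :
  reduced_triple i j l -> embedding (chebyshev_curve k i j l).
Proof.
case=> -[i_gt0 j_gt0 _].
case=> [one|[_ _ _ [_ _ /(pgcd_eq1 l i_gt0 j_gt0)[]]]]; last first.
  exact: chebyshev_curve_embedding.
(* A triple containing 1 need not be pairwise coprime, but its coordinate [T_1 = 'X] alone generates
   [k[t]]. *)
pose h := tnth (chebyshev_curve k i j l).
suff gX : generated h 'X by move=> p; apply: (generatedT gX).
move: one; rewrite !inE => /or3P[] /eqP one.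
- by have := generated_gen h (@Ordinal 3 0 isT); rewrite /h (tnth_nth 0) /= -one.
- by have := generated_gen h (@Ordinal 3 1 isT); rewrite /h (tnth_nth 0) /= -one.
by have := generated_gen h (@Ordinal 3 2 isT); rewrite /h (tnth_nth 0) /= -one.
Qed.

Theorem proposition4p2 (k : fieldType) (hk : [pchar k]%R =i pred0)
    (i j l : nat) (hi : (0 < i)%N) (hj : (0 < j)%N) (hl : (0 < l)%N)
    (hpgcd : pgcd i j l = 1%N) :
  exists I J K : nat,
    [/\ reduced_triple I J K,
        chebyshev_sim k i j l I J K &
        algebraically_equivalent (chebyshev_curve k i j l)
                                 (chebyshev_curve k I J K)].
Proof.
have [cij cil cjl] := (pgcd_eq1 l hi hj).1 hpgcd.
have [I [J [K [red sim]]]] := coprime_reducible k hi hj hl cij cil cjl.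
exists I, J, K; split=> //; apply: chebyshev_sim_equivalent sim.
  exact: chebyshev_curve_embedding.
exact: reduced_triple_embedding.
Qed.
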